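(* Let $d\ge 2$ be an integer and let $q=p^n$ be a prime power, with $p$ prime, $n\ge 1$ and $p>d$. Then: (1) for every function $f:\Gamma\to\mathbb{C}$, $$\|(f\sigma)^\vee\|_{L^{2d}(\mathbb{F}_q^d,dx)}\le A^{1/2d}\,\|f\|_{L^2(\Gamma,d\sigma)};$$ (2) the constant $A^{1/2d}$ is optimal, i.e. it is the smallest constant for which this inequality holds for all $f:\Gamma\to\mathbb{C}$; (3) a nonzero $f:\Gamma\to\mathbb{C}$ attains equality in this inequality if and only if $|f|$ is constant on $\Gamma$.
   Context: $\mathbb{F}_q$ is the field with $q=p^n$ elements. The moment curve is $\Gamma:=\{\gamma(t):t\in\mathbb{F}_q\}\subset\mathbb{F}_q^d$, where $\gamma(t):=(t,t^2,\dots,t^d)$. $\sigma$ is the normalized counting measure on $\Gamma$ (each of the $q$ points has mass $1/q$), so $\|g\|_{L^2(\Gamma,d\sigma)}^2=\frac1q\sum_{\xi\in\Gamma}|g(\xi)|^2$. $dx$ is the counting measure on $\mathbb{F}_q^d$, so $\|F\|_{L^{2d}(\mathbb{F}_q^d,dx)}^{2d}=\sum_{x\in\mathbb{F}_q^d}|F(x)|^{2d}$. $\mathrm{Tr}:\mathbb{F}_q\to\mathbb{F}_p$ is the field trace $\mathrm{Tr}(y)=y+y^p+\dots+y^{p^{n-1}}$, $e(y):=\exp(2\pi i\,\mathrm{Tr}(y)/p)$, and $x\cdot\xi:=\sum_{i=1}^d x_i\xi_i$. The Fourier extension of $f:\Gamma\to\mathbb{C}$ is $$(f\sigma)^\vee(x):=\frac1q\sum_{\xi\in\Gamma}f(\xi)\,e(x\cdot\xi),\qquad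 x\in\mathbb{F}_q^d.$$ $\mathcal{P}_d$ is the set of non-increasing $d$-tuples $\ell=(\ell_1,\dots,\ell_d)$ of nonnegative integers with $\sum_i\ell_i=d$. For $\ell\in\mathcal{P}_d$ and $1\le j\le d$, $b_j(\ell):=\#\{1\le i\le d:\ell_i=j\}$, and $b_0(\ell):=\#\{1\le i\le d:\ell_i=0\}+(q-d)$. Put $$\binom{d}{\ell}:=\frac{d!}{\ell_1!\cdots\ell_d!},\qquad \binom{q}{b(\ell)}:=\frac{q!}{b_0(\ell)!\,b_1(\ell)!\cdots b_d(\ell)!},\qquad A:=\frac{1}{q^d}\sum_{\ell\in\mathcal{P}_d}\binom{d}{\ell}^2\binom{q}{b(\ell)}.$$ *)

(* Defs.v *)
From HB Require Import structures.
From mathcomp Require Import all_boot all_order all_algebra all_field.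
From mathcomp Require Import reals exp trigo.
From mathcomp Require Import complex.

Set Implicit Arguments.
Unset Strict Implicit.
Unset Printing Implicit Defensive.

Import Order.TTheory GRing.Theory Num.Theory.
Import ComplexField.Normc.

Local Open Scope ring_scope.
Local Open Scope complex_scope.

Definition moment_point (F : finFieldType) (d : nat) (t : F) : 'rV[F]_d :=
  \row_(i < d) t ^+ i.+1.

Definition moment_curve (F : finFieldType) (d : nat) : {set 'rV[F]_d} :=
  [set moment_point d t | t : F].

Definition Gamma (F : finFieldType) (d : nat) : finType :=
  {xi : 'rV[F]_d | xi \in moment_curve F d}.

Definition dot (F : finFieldType) (d : nat) (x xi : 'rV[F]_d) : F :=
  \sum_(i < d) x ord0 i * xi ord0 i.

Definition frob_sum (F : finFieldType) (p n : nat) (y : F) : F :=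
  \sum_(i < n) y ^+ (p ^ i).

(* The sum of the Frobenius conjugates lies in the prime subfield when
   #|F| = p ^ n; [fftrace] is the element of 'F_p with that image in F.
   The default 0 is then never used: see [fftraceE]. *)
Definition fftrace (F : finFieldType) (p n : nat) (y : F) : 'F_p :=
  odflt 0 [pick k : 'F_p | (k : nat)%:R == frob_sum p n y].

Lemma fftraceE (F : finFieldType) (p n : nat) (y : F) :
  prime p -> #|F| = (p ^ n)%N ->
  (fftrace p n y : nat)%:R = frob_sum p n y.
Proof.
move=> pp cF; have chF := card_finPcharP cF pp.
have fixs : frob_sum p n y ^+ p = frob_sum p n y.
  rewrite /frob_sum -(pFrobenius_autE chF) raddf_sum /=.
  under eq_bigr => i _ do rewrite pFrobenius_autE -exprM -expnSr.
  case: n cF => [|m] cF; first by rewrite !big_ord0.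
  by rewrite big_ord_recr big_ord_recl /= -cF expf_card expn0 expr1 addrC.
rewrite /fftrace; case: pickP => [k /eqP //|nk].
set s := frob_sum p n y in fixs nk *.
pose S := [seq (k : nat)%:R | k : 'F_p] : seq F.
have uS : uniq S.
  rewrite map_inj_uniq ?enum_uniq // => a b /eqP.
  wlog le_ab : a b / (a <= b)%N.
    move=> W; case: (leqP a b) => [|/ltnW] h;
      [exact: W | by rewrite eq_sym => /(W _ _ h)].
  rewrite eq_sym -subr_eq0 -natrB // -(dvdn_pcharf chF) => dv.
  have lb : (b < p)%N by rewrite -[X in (_ < X)%N](Fp_cast pp) ltn_ord.
  apply/val_inj/eqP; rewrite eqn_leq le_ab -subn_eq0 /=.
  move: dv; case: (posnP (b - a)%N) => [->//|h].
  by move=> /(dvdn_leq h) /leq_trans /(_ (leq_subr _ _)); rewrite leqNgt lb.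
have sS : s \notin S by apply/mapP => -[k _ e]; move: (nk k); rewrite e eqxx.
have p1 := prime_gt1 pp.
have szq : size ('X^p - 'X : {poly F}) = p.+1.
  by rewrite size_polyDl ?size_polyXn // size_polyN size_polyX ltnS.
have := @max_poly_roots _ ('X^p - 'X) (s :: S); rewrite /= uS sS szq.
rewrite -size_poly_eq0 szq /= size_image card_Fp // ltnn => /(_ isT) abs.
have [h|] := boolP (root ('X^p - 'X) s && all (root ('X^p - 'X)) S);
  first by have := abs h isT.
case/negP; rewrite rootE !hornerE fixs subrr eqxx /=.
apply/allP => _ /mapP[k _ ->].
by rewrite rootE !hornerE -(pFrobenius_autE chF) rmorph_nat subrr.
Qed.

(* exp (2 * pi * 'i * Tr y / p), with Tr y represented by a natural number
   below p. *)
Definition add_char (R : realType) (F : finFieldType) (p n : nat) (y : F) :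
    R[i] :=
  let theta := 2 * pi * (fftrace p n y : nat)%:R / p%:R in
  cos theta +i* sin theta.

Definition extension (R : realType) (F : finFieldType) (p n d : nat)
    (f : Gamma F d -> R[i]) (x : 'rV[F]_d) : R[i] :=
  #|F|%:R^-1 * \sum_(xi : Gamma F d) f xi * add_char R p n (dot x (val xi)).

Definition norm_L2_Gamma (R : realType) (F : finFieldType) (d : nat)
    (g : Gamma F d -> R[i]) : R :=
  Num.sqrt (#|F|%:R^-1 * \sum_(xi : Gamma F d) normc (g xi) ^+ 2).

Definition norm_Lr (R : realType) (F : finFieldType) (d r : nat)
    (h : 'rV[F]_d -> R[i]) : R :=
  (\sum_(x : 'rV[F]_d) normc (h x) ^+ r) `^ r%:R^-1.

(* Non-increasing d-tuples of nonnegative integers with sum d; the entries are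
   bounded by d, whence the type 'I_d.+1. *)
Definition partitions (d : nat) : {set d.-tuple 'I_d.+1} :=
  [set l : d.-tuple 'I_d.+1 |
     sorted geq (map val l) && (\sum_(i < d) tnth l i == d)%N].

(* b_j(l); the subtraction q - d is truncated, hence meaningful for d <= q. *)
Definition mult (q d : nat) (l : d.-tuple 'I_d.+1) (j : 'I_d.+1) : nat :=
  (#|[set i : 'I_d | tnth l i == j]| + (if j == ord0 then q - d else 0))%N.

Definition multinomial_parts (R : realType) (d : nat) (l : d.-tuple 'I_d.+1) :
    R :=
  d`!%:R / \prod_(i < d) (tnth l i)`!%:R.

Definition multinomial_mult (R : realType) (q d : nat)
    (l : d.-tuple 'I_d.+1) : R :=
  q`!%:R / \prod_(j < d.+1) (mult q l j)`!%:R.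

Definition sharp_A (R : realType) (q d : nat) : R :=
  (q ^ d)%:R^-1 *
  \sum_(l in partitions d) multinomial_parts R l ^+ 2 * multinomial_mult R q l.

Definition sharp_const (R : realType) (q d : nat) : R :=
  sharp_A R q d `^ (2 * d)%:R^-1.

(* Main.v *)
(* With a_xi = |f xi|^2, the d-th power of the extension is a character sum over
   d-tuples of points of the curve.  By Plancherel and Newton's identities (this
   is where p > d enters) only pairs of tuples that are permutations of each other
   contribute to its L^2 norm, so the left-hand side to the power 2d is
     q^-d * sum_(|alpha| = d) (d! / alpha!)^2 a^alpha,
   that is, q^-d * d!^2 times the coefficient of X^d in the product over xi of
   sum_k (a_xi X)^k / k!^2.  Replacing a pair (s, t) of values of a by a pair with
   the same sum and a larger product increases this coefficient, since
     sum_i C(k, i)^2 s^i t^(k - i) = sum_j C(k, 2j) C(2j, j) (s + t)^(k - 2j) (s t)^j;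
   finitely many such steps lead from a to the constant function with the same
   mean.  Sorting the exponents alpha identifies the value there with sharp_A. *)

Require Import Defs.
From mathcomp Require Import all_boot all_order all_algebra all_field.
From mathcomp Require Import reals exp trigo.
From mathcomp Require Import complex.
From mathcomp Require Import ring lra zify.

Set Implicit Arguments.
Unset Strict Implicit.
Unset Printing Implicit Defensive.

Import Order.TTheory GRing.Theory Num.Theory.
Import ComplexField.Normc.

Local Open Scope ring_scope.
Local Open Scope complex_scope.

(** * Counting functions with prescribed fibre sizes *)

(** Once the first entry [x] is fixed, the rest is a rearrangement of [rem x s]. This choice carries
    the weight [count_mem x s], and the weights add up to [size s]. *)
Lemma permutations_count_fact (T : finType) (s : seq T) :
  (size (permutations s) * \prod_(v : T) (count_mem v s)`!)%N = (size s)`!.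
Proof.
have [n] := ubnP (size s); elim: n s => // n IHn s le_s_n.
case: (posnP (size s)) => [/size0nil -> | s_gt0].
  by rewrite big1 // => v _; rewrite /= fact0.
rewrite (perm_size (permutationsE s_gt0)) size_allpairs_dep.
rewrite sumnE big_map big_distrl /=.
transitivity (\sum_(x <- undup s) count_mem x s * (size s).-1`!)%N; last first.
  rewrite -big_distrl /= -[X in _ = X`!](prednK s_gt0) factS (prednK s_gt0).
  congr (_ * _)%N; rewrite -[RHS](perm_size (perm_count_undup s)) size_flatten.
  by rewrite sumnE !big_map; apply: eq_bigr => x _; rewrite size_nseq.
apply: eq_big_seq => x; rewrite mem_undup => xs.
rewrite -(size_rem xs) -(IHn (rem x s)); last first.
  by rewrite size_rem //; case: (size s) s_gt0 le_s_n.
rewrite [RHS]mulnCA; congr (_ * _)%N.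
rewrite (bigD1 x) //= [in RHS](bigD1 x) //= mulnA.
rewrite (permP (perm_to_rem xs)) /= eqxx add1n factS; congr (_ * _)%N.
by apply: eq_bigr => v /negbTE nvx; rewrite (permP (perm_to_rem xs)) /= eq_sym nvx.
Qed.

Lemma card_ffun_perm_codom (I T : finType) (s : seq T) : size s = #|I| ->
  (#|[set t : {ffun I -> T} | perm_eq (codom t) s]| *
    \prod_(v : T) (count_mem v s)`!)%N = #|I|`!.
Proof.
move=> sz; rewrite -sz -permutations_count_fact; congr (_ * _)%N.
rewrite -(card_imset _ (can_inj (@fgraphK I T))) cardE.
rewrite -(size_map val); apply/perm_size/uniq_perm.
- by rewrite (map_inj_uniq val_inj) enum_uniq.
- exact: permutations_uniq.
move=> u; rewrite mem_permutations; apply/mapP/idP => [[v]|us].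
  by rewrite mem_enum => /imsetP[t]; rewrite inE => ht -> ->.
have su : size u == #|I| by rewrite (perm_size us) sz.
exists (Tuple su) => //; rewrite mem_enum; apply/imsetP.
by exists (Finfun (Tuple su)); rewrite ?FinfunK // inE codom_ffun FinfunK.
Qed.

(** * Newton's identities *)

Lemma deriv_prod (R : comNzRingType) (I : eqType) (r : seq I) (P : I -> {poly R}) :
  uniq r ->
  (\prod_(i <- r) P i)^`() = \sum_(i <- r) (P i)^`() * \prod_(j <- r | j != i) P j.
Proof.
elim: r => [|i r IHr] /=; first by rewrite !big_nil derivC.
case/andP=> ir ur; rewrite !big_cons derivM IHr // eqxx; congr (_ * _ + _).
  by rewrite [LHS]big_seq [RHS]big_seq_cond; apply: eq_bigl => j; rewrite andbC;
     case: eqP => [->|]; rewrite ?(negbTE ir) ?andbT.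
rewrite big_distrr /= [LHS]big_seq [RHS]big_seq; apply: eq_bigr => k kr.
rewrite big_cons; case: eqP => [e|_]; first by rewrite e kr in ir.
by rewrite mulrCA.
Qed.

(* Synthetic division of [h * ('X - c)] by ['X - c]; the sum telescopes. *)
Lemma coef_divXsubC (R : comNzRingType) (h : {poly R}) (c : R) (N j : nat) :
  (size h <= N)%N ->
  \sum_(k < N.+1) c ^+ k * (h * ('X - c%:P))`_(j.+1 + k) = h`_j.
Proof.
move=> sh; rewrite -(big_mkord xpredT (fun k => c ^+ k * (h * ('X - c%:P))`_(j.+1 + k))).
rewrite (telescope_sumr_eq (fun k => - (c ^+ k * h`_(j + k)))) => [|//|k _].
  rewrite expr0 mul1r addn0 opprK nth_default ?mulr0 ?oppr0 ?add0r //.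
  by rewrite (leq_trans sh) // -addSnnS leq_addl.
by rewrite mulrBr coefB coefMX coefMC addSn /= addnS exprS; ring.
Qed.

Section Newton.
Variables (R : fieldType) (d : nat).
Implicit Type t : 'I_d -> R.
Let g t : {poly R} := \prod_(i < d) ('X - (t i)%:P).

Let g_at t i : g t = (\prod_(j < d | j != i) ('X - (t j)%:P)) * ('X - (t i)%:P).
Proof. by rewrite /g (bigD1 i) //= mulrC. Qed.

Let size_g t : size (g t) = d.+1.
Proof. by rewrite /g -big_enum size_prod_XsubC size_enum_ord. Qed.

(** The derivative of [g] is the sum over [i] of the quotients of [g] by [X - t i]. Synthetic
    division expands each quotient in powers of [t i], and summing over [i] produces the power
    sums. *)
Lemma Newton_derivative t (j : nat) :
  \sum_(k < d.+1) (\sum_(i < d) t i ^+ k) * (g t)`_(j.+1 + k) = (g t)`_j.+1 *+ j.+1.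
Proof.
rewrite -coef_deriv deriv_prod ?index_enum_uniq // coef_sum.
under eq_bigr => k _ do rewrite big_distrl.
rewrite exchange_big /=; apply: eq_bigr => i _.
rewrite derivXsubC mul1r -(coef_divXsubC (t i) (N := d)).
  by apply: eq_bigr => k _; rewrite -g_at.
have := size_g t; rewrite (g_at t i) size_Mmonic ?monicXsubC //.
  by rewrite size_XsubC addn2 => -[->].
by apply/monic_neq0/rpred_prod => k _; exact: monicXsubC.
Qed.

(** Each [t i] is a root of [g]; adding up the values of [g] there supplies the index 0, which the
    derivative does not reach. *)
Lemma Newton_constant t :
  \sum_(k < d.+1) (\sum_(i < d) t i ^+ k) * (g t)`_k = 0.
Proof.
under eq_bigr => k _ do rewrite big_distrl.
rewrite exchange_big /= big1 // => i _.
transitivity (g t).[t i]; last by rewrite (g_at t i) !hornerE subrr mulr0.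
rewrite (horner_coef_wide _ (n := d.+1)) ?size_g //.
by apply: eq_bigr => k _; rewrite mulrC.
Qed.

(** The power sums determine the coefficients of [g] from the top down, each step dividing by some
    [d - j] between 1 and [d]. Equal products of monic linear factors then have equal roots with
    multiplicity. *)
Lemma power_sums_perm_eq t u :
  (forall k, (0 < k <= d)%N -> k%:R != 0 :> R) ->
  (forall k, (0 < k <= d)%N -> \sum_(i < d) t i ^+ k = \sum_(i < d) u i ^+ k) ->
  perm_eq (codom t) (codom u).
Proof.
move=> nz eq_tu; apply: prod_XsubC_eq.
have gE v : \prod_(x <- codom v) ('X - x%:P) = g v by rewrite big_map big_enum.
rewrite !gE.
have Newton_rec v j : (j <= d)%N -> \sum_(k < d.+1) (\sum_(i < d) v i ^+ k) * (g v)`_(j + k)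
    = (g v)`_j *+ j.
  by case: j => [|j] _; rewrite ?Newton_derivative // mulr0n -[RHS](Newton_constant v).
have g_top v : (g v)`_d = 1.
  by have /monicP := monic_prod_XsubC (index_enum 'I_d) xpredT v; rewrite lead_coefE size_g.
have coef_rec v j : (j < d)%N ->
    (g v)`_j * (d - j)%:R = - \sum_(k < d) (\sum_(i < d) v i ^+ k.+1) * (g v)`_(j + k.+1).
  (* The power sum of index 0 equals [d]; moving its term to the other side produces the factor
     [d - j]. *)
  move=> jd; have := Newton_rec v j (ltnW jd); rewrite big_ord_recl /= addn0.
  under eq_bigr => i _ do rewrite expr0.
  rewrite sumr_const card_ord => /(canRL (addKr _)) h.
  rewrite (_ : \sum_(k < d) _ = - (d%:R * (g v)`_j) + (g v)`_j *+ j) //.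
  by rewrite natrB ?(ltnW jd) // -mulr_natr; ring.
(* Downward induction on [j], measured by [d - j]; the coefficient of degree [d] is 1 and the higher
   ones are 0. *)
suff eqg m j : (d - j <= m)%N -> (g t)`_j = (g u)`_j.
  by apply/polyP => j; apply: (eqg (d - j)%N).
elim: m j => [|m IHm] j.
  rewrite leqn0 subn_eq0 leq_eqVlt => /predU1P[<-|dj]; first by rewrite !g_top.
  by rewrite !nth_default ?size_g.
case: (ltnP j d) => [jd dj|dj _]; last first.
  by apply: IHm; move: dj; rewrite -subn_eq0 => /eqP ->.
apply: (mulIf (nz (d - j)%N _)); first by rewrite subn_gt0 jd leq_subr.
rewrite !coef_rec //; congr (- _); apply: eq_bigr => k _.
by rewrite eq_tu ?ltn_ord // IHm //; lia.
Qed.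
End Newton.

(** * The moment as a coefficient *)

Lemma count_flatten_nseq (T : finType) (m : T -> nat) (v : T) :
  count_mem v (flatten [seq nseq (m x) x | x <- enum T]) = m v.
Proof.
rewrite count_flatten -map_comp sumnE big_map big_enum /= (bigD1 v) //= count_nseq /= eqxx mul1n.
by rewrite big1 ?addn0 // => x /negbTE nxv; rewrite count_nseq /= nxv.
Qed.

Lemma card_ffun_content (I T : finType) (m : T -> nat) : (\sum_v m v)%N = #|I| ->
  (#|[set t : {ffun I -> T} | [forall v, count_mem v (codom t) == m v]]| *
    \prod_(v : T) (m v)`!)%N = #|I|`!.
Proof.
move=> sm; pose s := flatten [seq nseq (m x) x | x <- enum T].
have sz : size s = #|I|.
  rewrite size_flatten /shape -map_comp sumnE big_map big_enum -sm.
  by apply: eq_bigr => x _; rewrite /= size_nseq.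
rewrite -(card_ffun_perm_codom sz); congr (_ * _)%N.
  apply: eq_card => t; rewrite !inE; apply/forallP/idP => [h|/permP h v].
    by apply/allP => x _; rewrite /= (eqP (h x)) count_flatten_nseq.
  by rewrite h count_flatten_nseq.
by apply: eq_bigr => v _; rewrite count_flatten_nseq.
Qed.

Lemma prod_codom_count (R : comNzRingType) (I T : finType) (t : I -> T) (a : T -> R) :
  \prod_i a (t i) = \prod_v a v ^+ count_mem v (codom t).
Proof.
rewrite (partition_big t xpredT) //=; apply: eq_bigr => v _.
rewrite (eq_bigr (fun=> a v)) => [|i /eqP -> //].
rewrite prodr_const; congr (_ ^+ _).
by rewrite /codom /image_mem count_map cardE size_filter -enumT; apply: eq_count => i.
Qed.

Lemma sum_count_mem (T : finType) (s : seq T) :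
  (\sum_v count_mem v s)%N = size s.
Proof.
elim: s => [|x s IHs] /=; first by rewrite big1.
by rewrite big_split /= IHs (bigD1 x) //= eqxx big1 // => v /negbTE; rewrite eq_sym => ->.
Qed.

Section Bessel.
Variable R : realFieldType.

(** Truncation of the series of the modified Bessel function [I_0(2 sqrt(a X))]; the omitted terms
    cannot affect the coefficient of [X^d] in a product. *)
Definition bessel_poly (d : nat) (a : R) : {poly R} :=
  \poly_(k < d.+1) (a ^+ k / k`!%:R ^+ 2).

Lemma coef_prod_bessel (G : finType) (d : nat) (a : G -> R) :
  (\prod_x bessel_poly d (a x))`_d =
  \sum_(m : {ffun G -> 'I_d.+1} | (\sum_x m x == d)%N)
    \prod_x (a x ^+ m x / (m x)`!%:R ^+ 2).
Proof.
under eq_bigr => x _ do rewrite /bessel_poly poly_def.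
rewrite bigA_distr_bigA /= coef_sum [RHS]big_mkcond /=; apply: eq_bigr => m _.
rewrite scaler_prod prodrXr coefZ coefXn eq_sym.
by case: eqP => _; rewrite ?mulr1 ?mulr0.
Qed.
Let factn0 n : n`!%:R != 0 :> R.
Proof. by rewrite pnatr_eq0 -lt0n fact_gt0. Qed.

Let prod_fact_neq0 (I : finType) (m : I -> nat) : \prod_v (m v)`!%:R != 0 :> R.
Proof. by apply/prodf_neq0. Qed.

(** Tuples are grouped by content [m]: there are [d! / m!] tuples [t] of content [m], each has as
    many partners [u], and every such pair gives the monomial [a^m]. *)
Lemma sum_perm_eq_bessel (G : finType) (d : nat) (a : G -> R) :
  \sum_(t : {ffun 'I_d -> G}) \sum_(u : {ffun 'I_d -> G} | perm_eq (codom t) (codom u))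
    \prod_i a (t i) = d`!%:R ^+ 2 * (\prod_x bessel_poly d (a x))`_d.
Proof.
rewrite coef_prod_bessel big_distrr /=.
have sum_count (t : {ffun 'I_d -> G}) : (\sum_v count_mem v (codom t) = d)%N.
  by rewrite sum_count_mem size_codom card_ord.
(* [inord] never falls back to its default here, since a count is at most [d]. *)
pose c (t : {ffun 'I_d -> G}) : {ffun G -> 'I_d.+1} := [ffun v => inord (count_mem v (codom t))].
have cE t v : c t v = count_mem v (codom t) :> nat.
  by rewrite ffunE inordK // ltnS -[leqRHS](sum_count t) (bigD1 v) //= leq_addr.
have card_content (m : G -> nat) : (\sum_v m v)%N = d ->
    #|[set t : {ffun 'I_d -> G} | [forall v, count_mem v (codom t) == m v]]|%:R =
    d`!%:R / (\prod_(v : G) (m v)`!%:R) :> R.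
  move=> sm; apply: (canRL (mulfK (prod_fact_neq0 _))).
  by rewrite -natr_prod -natrM card_ffun_content card_ord.
rewrite (partition_big c (fun m => (\sum_x m x == d)%N)) /=; last first.
  by move=> t _; apply/eqP; rewrite -[RHS](sum_count t); apply: eq_bigr => v _; exact: cE.
apply: eq_bigr => m /eqP sm.
transitivity (\sum_(t : {ffun 'I_d -> G} | c t == m)
      (d`!%:R / (\prod_v (m v)`!%:R)) * \prod_v a v ^+ m v).
  apply: eq_bigr => t /eqP <-; rewrite sumr_const prod_codom_count -[LHS]mulr_natl.
  congr (_ * _); last by apply: eq_bigr => v _; rewrite cE.
  under eq_bigr => v _ do rewrite cE.
  rewrite -(card_content _ (sum_count t)); congr (_%:R); apply: eq_card => u.
  rewrite !inE; apply/permP/forallP => [h v|h]; first by rewrite h.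
  by apply/permP/allP => v _; rewrite /= (eqP (h v)).
rewrite sumr_const -[LHS]mulr_natl.
have -> : #|[pred t : {ffun 'I_d -> G} | c t == m]| =
  #|[set t : {ffun 'I_d -> G} | [forall v, count_mem v (codom t) == m v]]|.
  apply: eq_card => t; rewrite !inE; apply/eqP/forallP => [<- v|h]; first by rewrite cE.
  by apply/ffunP => v; apply/val_inj; rewrite /= cE; exact/eqP.
rewrite card_content // big_split /= prodfV prodrXl.
by field; rewrite prod_fact_neq0.
Qed.
End Bessel.
(** * The constant function is the maximizer *)

Section Smoothing.
Variable R : realFieldType.
Implicit Types s t : R.

(** Only the term of index [m / 2] in the binomial expansion has degree [m], and it exists only for
    even [m]. *)
Lemma coef_addCXn2 s t (m : nat) :
  ((t%:P + s *: 'X^2) ^+ m)`_m =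
  if odd m then 0 else (s * t) ^+ m./2 *+ 'C(m, m./2).
Proof.
rewrite exprDn coef_sum.
have E (i : 'I_m.+1) : (t%:P ^+ (m - i) * (s *: 'X^2) ^+ i *+ 'C(m, i))`_m =
    if (m == i.*2)%N then t ^+ (m - i) * s ^+ i *+ 'C(m, i) else 0.
  rewrite coefMn -rmorphXn coefCM exprZn coefZ -exprM coefXn mul2n.
  by case: eqP => _; rewrite ?mulr1 ?mulr0 ?mul0rn.
rewrite (eq_bigr _ (fun i _ => E i)) -big_mkcond /=.
case: ifP => [om|/negbT em].
  by rewrite big1 // => i /eqP e; rewrite e odd_double in om.
have hm : (m./2 < m.+1)%N by rewrite ltnS; lia.
rewrite (big_pred1 (Ordinal hm)) => [|i /=].
  by rewrite exprMn mulrC (_ : m - m./2 = m./2)%N //; lia.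
by rewrite -val_eqE /=; apply/eqP/eqP; lia.
Qed.

Lemma coef_addCX_exp s t (k i : nat) : (i <= k)%N ->
  ((t%:P + s *: 'X) ^+ k)`_i = t ^+ (k - i) * s ^+ i *+ 'C(k, i).
Proof.
rewrite -ltnS => ik; rewrite exprDn coef_sum (bigD1 (Ordinal ik)) //= big1 => [|j nj].
  by rewrite addr0 coefMn -rmorphXn coefCM exprZn coefZ coefXn eqxx mulr1.
rewrite coefMn -rmorphXn coefCM exprZn coefZ coefXn.
by rewrite -val_eqE /= eq_sym in nj; rewrite (negbTE nj) !mulr0 mul0rn.
Qed.

Lemma sum_bin_sqr s t (k : nat) :
  \sum_(i < k.+1) 'C(k, i)%:R ^+ 2 * s ^+ i * t ^+ (k - i) =
  \sum_(m < k.+1) 'C(k, m)%:R * (s + t) ^+ (k - m) *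
    (if odd m then 0 else (s * t) ^+ m./2 *+ 'C(m, m./2)).
Proof.
(* Expand [((t + s X) (1 + X)) ^+ k = ((s + t) X + (t + s X ^+ 2)) ^+ k] in two ways. *)
transitivity ((((t%:P + s *: 'X) * (1 + 'X)) ^+ k)`_k).
  rewrite exprMn coefM; apply: eq_bigr => i _.
  have ik : (i <= k)%N by rewrite -ltnS.
  rewrite -[in (1 + 'X)](scale1r 'X) !coef_addCX_exp ?leq_subr // bin_sub //.
  by rewrite !expr1n mulr1 -(mulr_natr (t ^+ _ * _)); ring.
have -> : (t%:P + s *: 'X) * (1 + 'X) = (s + t) *: 'X + (t%:P + s *: 'X^2).
  rewrite mulrDr mulr1 mulrDl scalerDl -!scalerAl -expr2 -(mul_polyC t); ring.
rewrite exprDn coef_sum; apply: eq_bigr => m _.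
rewrite coefMn exprZn -scalerAl coefZ coefXnM.
rewrite ltnNge leq_subr /= subKn -1?ltnS // coef_addCXn2 -[LHS]mulr_natl mulrA //.
Qed.

(** For a fixed sum [s + t], [sum_bin_sqr] exhibits the expression as a polynomial in [s * t] with
    nonnegative coefficients. *)
Lemma sum_bin_sqr_le s t s' t' (k : nat) : 0 <= s -> 0 <= t -> 0 <= s' -> 0 <= t' ->
  s + t = s' + t' -> s * t <= s' * t' ->
  \sum_(i < k.+1) 'C(k, i)%:R ^+ 2 * s ^+ i * t ^+ (k - i) <=
  \sum_(i < k.+1) 'C(k, i)%:R ^+ 2 * s' ^+ i * t' ^+ (k - i).
Proof.
move=> s0 t0 s'0 t'0 e le; rewrite !sum_bin_sqr -e; apply: ler_sum => m _.
apply: ler_wpM2l; first by rewrite mulr_ge0 ?ler0n ?exprn_ge0 ?addr_ge0.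
by case: ifP => // _; rewrite lerMn2r lerXn2r ?orbT // nnegrE mulr_ge0.
Qed.

Lemma sum_bin_sqr_lt s t s' t' (k : nat) : 0 <= s -> 0 <= t -> 0 <= s' -> 0 <= t' ->
  0 < s + t -> (1 < k)%N -> s + t = s' + t' -> s * t < s' * t' ->
  \sum_(i < k.+1) 'C(k, i)%:R ^+ 2 * s ^+ i * t ^+ (k - i) <
  \sum_(i < k.+1) 'C(k, i)%:R ^+ 2 * s' ^+ i * t' ^+ (k - i).
Proof.
move=> s0 t0 s'0 t'0 st0 k1 e lt; rewrite !sum_bin_sqr -e.
(* Strictness comes from the term [m = 2], linear in [s * t] with the positive coefficient
   [2 C(k, 2) (s + t)^(k - 2)]; the other terms are compared weakly. *)
have k2 : (2 < k.+1)%N by [].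
rewrite (bigD1 (Ordinal k2)) //= [ltRHS](bigD1 (Ordinal k2)) //=.
apply: ltr_leD.
  by rewrite !expr1 ltr_pM2l ?ltrMn2r // mulr_gt0 ?exprn_gt0 // ltr0n bin_gt0.
apply: ler_sum => m _; apply: ler_wpM2l; first by rewrite mulr_ge0 ?ler0n ?exprn_ge0 ?addr_ge0.
by case: ifP => // _; rewrite lerMn2r lerXn2r ?orbT ?ltW // nnegrE mulr_ge0.
Qed.
End Smoothing.
(** This rests on [C(k, i) / k! = 1 / (i! (k - i)!)]; the bound [k <= d] keeps all indices within
    the truncation. *)
Lemma coef_bessel_mul (R : realFieldType) (d k : nat) (s t : R) : (k <= d)%N ->
  (bessel_poly d s * bessel_poly d t)`_k =
  (\sum_(i < k.+1) 'C(k, i)%:R ^+ 2 * s ^+ i * t ^+ (k - i)) / k`!%:R ^+ 2.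
Proof.
move=> kd; rewrite coefM big_distrl /=; apply: eq_bigr => i _.
have ik : (i <= k)%N by rewrite -ltnS.
rewrite !coef_poly !ltnS (leq_trans ik kd) (leq_trans (leq_subr _ _) kd).
have fn0 n : n`!%:R != 0 :> R by rewrite pnatr_eq0 -lt0n fact_gt0.
rewrite -(bin_fact ik) !natrM.
have b0 : 'C(k, i)%:R != 0 :> R by rewrite pnatr_eq0 -lt0n bin_gt0.
by field; rewrite !fn0 b0.
Qed.

Section Maximum.
Variables (R : realFieldType) (G : finType) (d : nat).
Hypothesis d_gt1 : (1 < d)%N.
Implicit Types (a b : G -> R) (m : R).

Let coefB (a : G -> R) : R := (\prod_x bessel_poly d (a x))`_d.

(** The factors away from [x] and [y] have a common product [Q] with nonnegative coefficients and
    constant term 1. In the convolution giving the coefficient of [X^d], the term with the constant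
    coefficient of [Q] increases strictly and the others do not decrease. *)
Lemma coef_prod_bessel_smooth a b (x y : G) : x != y ->
  (forall z, 0 <= a z) -> (forall z, 0 <= b z) ->
  (forall z, z != x -> z != y -> a z = b z) ->
  a x + a y = b x + b y -> a x * a y < b x * b y ->
  coefB a < coefB b.
Proof.
move=> nxy a0 b0 eq_ab eS ltP; rewrite /coefB.
have yx : y != x by rewrite eq_sym.
rewrite (bigD1 x) //= (bigD1 y) //= [in ltRHS](bigD1 x) //= [in ltRHS](bigD1 y) //=.
rewrite !mulrA.
have -> : \prod_(i | (i != x) && (i != y)) bessel_poly d (b i) =
          \prod_(i | (i != x) && (i != y)) bessel_poly d (a i).
  by apply: eq_bigr => z /andP[zx zy]; rewrite eq_ab.
set Q := \prod_(i | _) _.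
have Q0 : Q`_0 = 1.
  rewrite /Q; apply: (big_ind (fun p : {poly R} => p`_0 = 1)); first by rewrite coef1.
    by move=> p q hp hq; rewrite coef0M hp hq mulr1.
  by move=> z _; rewrite coef_poly /= expr0 fact0 expr1n divr1.
have Qge k : 0 <= Q`_k.
  rewrite /Q; elim/big_ind: _ k => [k|p q hp hq k|z _ k].
  - by rewrite coef1 ler0n.
  - by rewrite coefM sumr_ge0 // => i _; rewrite mulr_ge0.
  - by rewrite coef_poly; case: ifP => // _; rewrite divr_ge0 ?exprn_ge0 ?ler0n.
(* If both values of [a] vanished, so would both values of [b], against the strict inequality of the
   products. *)
have S0 : 0 < a x + a y.
  rewrite lt_neqAle addr_ge0 // andbT; apply/eqP => e.
  have := ltP; suff -> : b x * b y = a x * a y by rewrite ltxx.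
  have /eqP := esym e; rewrite paddr_eq0 // => /andP[/eqP-> /eqP->].
  have /eqP := esym e; rewrite eS paddr_eq0 // => /andP[/eqP-> _].
  by rewrite !mul0r.
rewrite !coefM !big_ord_recr /= !subnn Q0 !mulr1 !coef_bessel_mul //.
apply: ler_ltD.
  apply: ler_sum => k _; apply: ler_wpM2r => //.
  rewrite !coef_bessel_mul ?(ltnW (ltn_ord k)) //; apply: ler_wpM2r.
    by rewrite invr_ge0 exprn_ge0 // ler0n.
  by apply: sum_bin_sqr_le => //; exact: ltW.
rewrite ltr_pM2r; first exact: sum_bin_sqr_lt.
by rewrite invr_gt0 exprn_gt0 // ltr0n fact_gt0.
Qed.

(** Induction on the number of values off the mean. The first smoothing step is already strict, so a
    weak inequality suffices afterwards. *)
Lemma coef_prod_bessel_max a m :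
  (forall z, 0 <= a z) -> \sum_z a z = #|G|%:R * m -> (exists z, a z != m) ->
  coefB a < coefB (fun=> m).
Proof.
have [n] := ubnP #|[set z | a z != m]|; elim: n a => // n IHn a le_n a0 sa [z0 nz0].
have dev0 : \sum_z (a z - m) = 0 by rewrite sumrB sa sumr_const mulr_natl subrr.
(* The deviations from the mean sum to zero and one of them is nonzero, so both signs occur. *)
have [x xm] : exists x, m < a x.
  apply/existsP; apply: contraNT nz0 => /existsPn h; rewrite -subr_eq0 -oppr_eq0 opprB.
  apply/eqP/(@psumr_eq0P _ _ xpredT (fun z => m - a z)) => [z _||//].
    by rewrite subr_ge0 leNgt h.
  under eq_bigr => z _ do rewrite -opprB.
  by rewrite sumrN dev0 oppr0.
have [y ym] : exists y, a y < m.
  apply/existsP; apply: contraNT nz0 => /existsPn h; rewrite -subr_eq0.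
  apply/eqP/(@psumr_eq0P _ _ xpredT (fun z => a z - m)) => // z _.
  by rewrite subr_ge0 leNgt h.
have nxy : x != y by apply: contraTneq (lt_trans ym xm) => ->; rewrite ltxx.
(* Moving the value at x to the mean decreases the number of values off the mean. *)
pose b z := if z == x then m else if z == y then a x + a y - m else a z.
have bx : b x = m by rewrite /b eqxx.
have by' : b y = a x + a y - m by rewrite /b eq_sym (negbTE nxy) eqxx.
have bz z : z != x -> z != y -> a z = b z by rewrite /b => /negbTE-> /negbTE->.
have yx : y != x by rewrite eq_sym.
have m0 : 0 <= m by rewrite (le_trans (a0 y)) // ltW.
have b0 z : 0 <= b z.
  by rewrite /b; case: eqP => // _; case: eqP => // _; have := a0 y; lra.
apply: (@lt_le_trans _ _ (coefB b)).
  apply: (@coef_prod_bessel_smooth a b x y) => //; rewrite bx by'; first by ring.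
  by rewrite -subr_gt0 (_ : _ - _ = (a x - m) * (m - a y)) ?mulr_gt0 ?subr_gt0 //; ring.
have [/existsP h|/existsPn h] := boolP [exists z, b z != m]; last first.
  rewrite /coefB (eq_bigr (fun=> bessel_poly d m)) // => z _.
  by have := h z; rewrite negbK => /eqP ->.
apply/ltW/IHn => //.
  move: le_n; rewrite ltnS; apply: leq_trans; apply: proper_card; apply/properP; split.
    apply/subsetP => z; rewrite !inE /b; case: (z =P x) => [_|_]; first by rewrite eqxx.
    by case: (z =P y) => [-> _|//]; rewrite lt_eqF.
  by exists x; rewrite !inE ?bx ?eqxx // gt_eqF.
rewrite -sa (bigD1 x) //= (bigD1 y) //= [RHS](bigD1 x) //= [X in _ = _ + X](bigD1 y) //=.
rewrite (eq_bigr a) => [|z /andP[zx zy]]; last by rewrite -bz.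
by rewrite bx by'; ring.
Qed.
End Maximum.

(** * The sharp constant *)

Section SharpConstant.
Variables (R : realType) (G : finType) (d : nat).
Hypothesis d_le_G : (d <= #|G|)%N.

(** The zeros extend a partition to the full list of values of a function on [G]; they account for
    the summand [q - d] in [mult]. *)
Let pad (l : d.-tuple 'I_d.+1) : seq 'I_d.+1 := l ++ nseq (#|G| - d) ord0.

Let geq_ord : rel 'I_d.+1 := relpre val geq.

Let sorted_parts (m : {ffun G -> 'I_d.+1}) : d.-tuple 'I_d.+1 :=
  [tuple nth ord0 (sort geq_ord (codom m)) i | i < d].

Let geq_ord_total : total geq_ord.
Proof. by move=> x y; rewrite /geq_ord /= orbC leq_total. Qed.

Let geq_ord_trans : transitive geq_ord.
Proof. by move=> y x z /= xy yz; exact: leq_trans yz xy. Qed.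

Let geq_ord_anti : antisymmetric geq_ord.
Proof. by move=> x y /= xy; apply/val_inj/eqP; rewrite eqn_leq andbC. Qed.

Let sum_codom (m : {ffun G -> 'I_d.+1}) :
  (\sum_x m x = \sum_(j <- codom m) j)%N.
Proof. by rewrite big_map big_enum. Qed.

Let sum_pad l : (\sum_(j <- pad l) j = \sum_(i < d) tnth l i)%N.
Proof.
rewrite big_cat /= [X in (_ + X)%N]big1_seq ?addn0 ?big_tuple // => j.
by case/nseqP=> ->.
Qed.

Let partitionsE (l : d.-tuple 'I_d.+1) :
  (l \in partitions d) = sorted geq_ord l && (\sum_(i < d) tnth l i == d)%N.
Proof. by rewrite inE sorted_map. Qed.

(** A positive value beyond position [d] of the sorted list would force the [d] values before it to
    be at least 1, and the total would exceed [d]. *)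
Let pad_sorted_parts (m : {ffun G -> 'I_d.+1}) : (\sum_x m x)%N = d ->
  sort geq_ord (codom m) = pad (sorted_parts m).
Proof.
rewrite sum_codom -(perm_big _ (permEl (perm_sort geq_ord _))) /=.
set s := sort _ _ => sum_s.
have sz : size s = #|G| by rewrite size_sort size_codom.
have srt : sorted geq_ord s by exact: sort_sorted.
have take_s : take d s = sorted_parts m :> seq _.
  apply: (@eq_from_nth _ ord0) => [|i]; first by rewrite size_takel ?sz // size_tuple.
  rewrite size_takel ?sz // => id; rewrite nth_take //.
  by have := nth_mktuple (fun i : 'I_d => nth ord0 s i) ord0 (Ordinal id).
rewrite -[LHS](cat_take_drop d) take_s; congr (_ ++ _).
rewrite -sz -size_drop; apply/all_pred1P/allP => x /= xs; apply/eqP/val_inj/eqP => /=.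
rewrite -leqn0 leqNgt; apply/negP => x0.
have ge1 y : y \in take d s -> (1 <= y)%N.
  move=> ys; apply: leq_trans x0 _.
  move: srt; rewrite -[in sorted _ s](cat_take_drop d s) (sorted_pairwise geq_ord_trans).
  by rewrite pairwise_cat => /and3P[/allrelP h _ _]; exact: h.
move: sum_s; rewrite -(cat_take_drop d s) big_cat /= => sum_s.
have : (d <= \sum_(j <- take d s) j)%N.
  rewrite -[leqLHS](_ : \sum_(j <- take d s) 1 = d)%N.
    by rewrite big_seq [leqRHS]big_seq; apply: leq_sum => y; exact: ge1.
  by rewrite sum1_size size_takel // sz.
have : (x <= \sum_(j <- drop d s) j)%N by rewrite (big_rem x) //= leq_addr.
lia.
Qed.

Let sorted_sorted_parts (m : {ffun G -> 'I_d.+1}) : (\sum_x m x)%N = d ->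
  sorted geq_ord (sorted_parts m).
Proof.
move=> sm; have := sort_sorted geq_ord_total (codom m).
rewrite pad_sorted_parts // !(sorted_pairwise geq_ord_trans) pairwise_cat.
by case/and3P.
Qed.

(** A non-increasing list is determined by its multiset of entries; this describes the fibre over
    [l] in a form that can be counted. *)
Let sorted_parts_eq (m : {ffun G -> 'I_d.+1}) l : l \in partitions d ->
  (\sum_x m x == d)%N && (sorted_parts m == l) = perm_eq (codom m) (pad l).
Proof.
rewrite partitionsE => /andP[l_sort /eqP l_sum].
apply/andP/idP => [[/eqP sm /eqP <-]|h].
  by rewrite -pad_sorted_parts // perm_sym perm_sort.
have sm : (\sum_x m x)%N = d by rewrite sum_codom (perm_big _ h) sum_pad.
split; first exact/eqP.
have: perm_eq (pad (sorted_parts m)) (pad l) by rewrite -pad_sorted_parts // perm_sort.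
rewrite perm_cat2r => p; apply/eqP/val_inj.
exact: (sorted_eq geq_ord_trans geq_ord_anti (sorted_sorted_parts sm) l_sort p).
Qed.

(** The exponents are grouped by their sorted values [l]: the summand depends on [l] alone, and the
    fibre over [l] has [multinomial_mult] elements. *)
Lemma sharp_A_bessel :
  sharp_A R #|G| d =
  (#|G| ^ d)%:R^-1 * (d`!%:R ^+ 2 * (\prod_(x : G) bessel_poly d (1 : R))`_d).
Proof.
rewrite coef_prod_bessel; congr (_ * _).
rewrite (partition_big sorted_parts (fun l => l \in partitions d)) /=; last first.
  move=> m /eqP sm; rewrite partitionsE sorted_sorted_parts //= -sum_pad.
  by rewrite -pad_sorted_parts // (perm_big _ (permEl (perm_sort _ _))) -sum_codom sm.
rewrite big_distrr /=; apply: eq_bigr => l l_part.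
rewrite (eq_bigl _ _ (fun m => sorted_parts_eq m l_part)).
pose w : R := \prod_(j <- l) (j`!%:R ^+ 2)^-1.
rewrite (eq_bigr (fun=> w)) => [|m h]; last first.
  transitivity (\prod_(j <- codom m) (nat_of_ord j)`!%:R ^- 2 : R).
    by rewrite big_map big_enum; apply: eq_bigr => x _; rewrite expr1n mul1r.
  rewrite (perm_big _ h) big_cat /= [X in _ * X]big1_seq ?mulr1 // => j.
  by case/nseqP=> -> _; rewrite fact0 expr1n invr1.
rewrite sumr_const.
have sz : size (pad l) = #|G| by rewrite size_cat size_tuple size_nseq subnKC.
have cnt j : count_mem j (pad l) = mult #|G| l j.
  rewrite count_cat count_nseq /= mulnC /mult; congr (_ + _)%N; last first.
    by rewrite eq_sym; case: eqP; rewrite ?muln1 ?muln0.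
  rewrite cardsE cardE size_filter -enumT -[in LHS](map_tnth_enum l) count_map.
  exact: eq_count.
have := card_ffun_perm_codom sz.
under eq_bigr => j _ do rewrite cnt.
have prod_fact_neq0 (I : finType) (k : I -> nat) : \prod_v (k v)`!%:R != 0 :> R.
  by apply/prodf_neq0 => v _; rewrite pnatr_eq0 -lt0n fact_gt0.
move=> /(congr1 (fun k : nat => k%:R : R)); rewrite natrM natr_prod.
move/(canRL (mulfK (prod_fact_neq0 _ _))); rewrite cardsE => N.
rewrite /multinomial_mult -N -[w *+ _]mulr_natr mulrA; congr (_ * _).
rewrite /multinomial_parts expr_div_n; congr (_ * _).
by rewrite /w big_tuple prodfV prodrXl.
Qed.
End SharpConstant.

(** * Additive characters *)

Section CircleExp.
Variable R : realType.
Implicit Types x y : R.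

Definition cis x : R[i] := cos x +i* sin x.

Lemma cisD x y : cis (x + y) = cis x * cis y.
Proof. by rewrite /cis cosD sinD; simpc; congr (_ +i* _); rewrite addrC. Qed.

Lemma cisMn x (k : nat) : cis (x *+ k) = cis x ^+ k.
Proof.
elim: k => [|k IHk]; first by rewrite mulr0n expr0 /cis cos0 sin0.
by rewrite mulrS exprS cisD IHk.
Qed.

Lemma cis2pi : cis (pi *+ 2) = 1.
Proof. by rewrite /cis cos2pi sin2pi. Qed.

(** The real part is [1 - 2 sin(x / 2)^2], and the half angle lies strictly between 0 and [pi]. *)
Lemma cis_neq1 x : 0 < x < pi *+ 2 -> cis x != 1.
Proof.
move=> /andP[x0 x2pi]; apply/eqP => -[+ _]; rewrite (splitr x) -mulr2n cos_mulr2n.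
have: 0 < sin (x / 2) by apply: sin_gt0_pi; lra.
have := cos2Dsin2 (x / 2); nra.
Qed.

Lemma conjc_cis x : cis x * conjc (cis x) = 1.
Proof. by rewrite /cis; simpc; rewrite -!expr2 cos2Dsin2 mulrC addNr. Qed.
End CircleExp.

Section AdditiveCharacter.
Variables (R : realType) (F : finFieldType) (p n : nat).
Hypotheses (p_pr : prime p) (n_gt0 : (0 < n)%N) (cardF : #|F| = (p ^ n)%N).

Let pF : p \in [pchar F] := card_finPcharP cardF p_pr.

Let natr_eq_mod (a b : nat) : a%:R = b%:R :> F -> a == b %[mod p].
Proof.
wlog le_ba : a b / (b <= a)%N => [W e|e].
  by case/orP: (leq_total b a) => h; [exact: W | rewrite eq_sym; exact: W].
by rewrite eqn_mod_dvd // (dvdn_pcharf pF) natrB // e subrr.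
Qed.

Let zeta : R[i] := cis (2 * pi / p%:R).

Let p_neq0 : p%:R != 0 :> R.
Proof. by rewrite pnatr_eq0 -lt0n prime_gt0. Qed.

Let add_charE (y : F) : add_char R p n y = zeta ^+ fftrace p n y.
Proof.
rewrite -cisMn /add_char -/(cis _); congr cis.
by rewrite -[RHS]mulr_natr mulrAC.
Qed.

Let zeta_p : zeta ^+ p = 1.
Proof. by rewrite -cisMn -[_ *+ p]mulr_natr divfK // mulr_natl cis2pi. Qed.

Let frob_sumD (y z : F) : frob_sum p n (y + z) = frob_sum p n y + frob_sum p n z.
Proof.
rewrite /frob_sum -big_split /=; apply: eq_bigr => i _.
by rewrite exprDn_pchar // pnatX pnatE // pF.
Qed.

(** The representatives of the traces below [p] add up only modulo [p], which suffices because
    [zeta ^+ p = 1]. *)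
Lemma add_charD (y z : F) : add_char R p n (y + z) = add_char R p n y * add_char R p n z.
Proof.
rewrite !add_charE -exprD -(expr_mod (_ + _) zeta_p) -(expr_mod (fftrace p n (y + z)) zeta_p).
by congr (_ ^+ _); apply/eqP/natr_eq_mod; rewrite natrD !fftraceE.
Qed.

Lemma add_char0 : add_char R p n (0 : F) = 1.
Proof.
have nz : add_char R p n (0 : F) != 0.
  apply/eqP => e; have := conjc_cis (2 * pi * (fftrace p n (0 : F) : nat)%:R / p%:R : R).
  by rewrite -[cis _]/(add_char R p n (0 : F)) e mul0r => /esym/eqP; rewrite oner_eq0.
by apply: (mulfI nz); rewrite -add_charD addr0 mulr1.
Qed.

Lemma conjc_add_char (y : F) : conjc (add_char R p n y) = add_char R p n (- y).
Proof.
have e := conjc_cis (2 * pi * (fftrace p n y : nat)%:R / p%:R : R).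
rewrite -[LHS]mulr1 -add_char0 -(subrr y) add_charD mulrA [_ * add_char R p n y]mulrC.
by rewrite e mul1r.
Qed.

(** The trace is a nonzero polynomial of degree at most [p^(n-1)], so it cannot vanish at all [p^n]
    elements. Where it does not vanish, the character is [zeta^k] with [0 < k < p]. *)
Lemma add_char_nontrivial : exists y : F, add_char R p n y != 1.
Proof.
have [y ny] : exists y : F, frob_sum p n y != 0.
  apply/existsP; apply: contraT => /existsPn h.
  pose P : {poly F} := \sum_(i < n) 'X^(p ^ i).
  have szP : (size P <= (p ^ n.-1).+1)%N.
    apply: (leq_trans (size_sum _ _ _)); apply/bigmax_leqP => i _.
    rewrite size_polyXn ltnS leq_exp2l ?prime_gt1 // -ltnS prednK //.
  have nzP : P != 0.
    (* The coefficient of [X] is 1, since only the index [i = 0] gives this monomial. *)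
    apply/eqP => /(congr1 (coefp 1%N)); rewrite /= coef0 coef_sum.
    rewrite (bigD1 (Ordinal n_gt0)) //= expn0 coefXn eqxx big1 ?addr0 => [|i ni].
      by move/eqP; rewrite oner_eq0.
    rewrite coefXn -[X in X == _](expn0 p) eqn_exp2l ?prime_gt1 //.
    by move: ni; rewrite -val_eqE /= eq_sym => /negbTE ->.
  have := @max_poly_roots _ P (enum F) nzP; rewrite enum_uniq -cardE cardF.
  have -> : all (root P) (enum F).
    apply/allP => y _; rewrite rootE /P horner_sum.
    by under eq_bigr => i _ do rewrite hornerXn; have := h y; rewrite negbK.
  move=> /(_ isT isT) lt_p; have := leq_trans lt_p szP.
  by rewrite ltnS leq_exp2l ?prime_gt1 // -ltnS prednK // ltnn.
exists y; rewrite add_charE -cisMn; apply: cis_neq1.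
have k0 : (0 < fftrace p n y)%N.
  by rewrite lt0n; apply: contraNneq ny => k0; rewrite -fftraceE // k0.
have kp : (fftrace p n y < p)%N by rewrite -[ltnRHS](Fp_cast p_pr).
have p0 : 0 < p%:R :> R by rewrite ltr0n prime_gt0.
rewrite -[_ *+ fftrace _ _ _]mulr_natr mulrAC ltr_pdivlMr // ltr_pdivrMr // mul0r -[pi *+ 2]mulr_natl.
by rewrite ltr_pM2l ?mulr_gt0 ?pi_gt0 ?ltr0n // ltr_nat.
Qed.

End AdditiveCharacter.

(** * Bilinearity of the dot product *)

Section Dot.
Variables (F : finFieldType) (d : nat).
Implicit Types x y w : 'rV[F]_d.

Lemma dotDl x y w : dot (x + y) w = dot x w + dot y w.
Proof. by rewrite /dot -big_split; apply: eq_bigr => i _; rewrite mxE mulrDl. Qed.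

Lemma dotDr x w y : dot x (w + y) = dot x w + dot x y.
Proof. by rewrite /dot -big_split; apply: eq_bigr => i _; rewrite mxE mulrDr. Qed.

Lemma dotNr x w : dot x (- w) = - dot x w.
Proof. by rewrite /dot -sumrN; apply: eq_bigr => i _; rewrite mxE mulrN. Qed.

Lemma dot0r x : dot x 0 = 0.
Proof. by rewrite /dot big1 // => i _; rewrite mxE mulr0. Qed.

Lemma dot_delta (i : 'I_d) (c : F) w : dot (c *: delta_mx ord0 i) w = c * w ord0 i.
Proof.
rewrite /dot (bigD1 i) //= big1 ?addr0 => [|j nji]; rewrite !mxE ?eqxx ?mulr1 //.
by rewrite (negbTE nji) andbF mulr0 mul0r.
Qed.
End Dot.

(** * Orthogonality of the additive characters *)

Section Orthogonality.
Variables (R : realType) (F : finFieldType) (p n d : nat).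
Hypotheses (p_pr : prime p) (n_gt0 : (0 < n)%N) (cardF : #|F| = (p ^ n)%N).

(** For nonzero [w], translating [x] by a suitable [v] multiplies the sum by a character value
    different from 1, so the sum is zero. *)
Lemma sum_add_char_dot (w : 'rV[F]_d) :
  \sum_x add_char R p n (dot x w) = (if w == 0 then (#|F| ^ d)%:R else 0).
Proof.
case: eqP => [->|/eqP nw].
  rewrite (eq_bigr (fun=> 1)) => [|x _]; last by rewrite dot0r (add_char0 _ p_pr cardF).
  by rewrite sumr_const card_mx mul1n.
have [i wi] : exists i, w ord0 i != 0.
  apply/existsP; apply: contraT => /existsPn h; case/eqP: nw; apply/rowP => i.
  by have := h i; rewrite negbK mxE => /eqP.
have [c nc] := add_char_nontrivial R p_pr n_gt0 cardF.
pose v := (c / w ord0 i) *: delta_mx ord0 i : 'rV[F]_d.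
have vw : dot v w = c by rewrite dot_delta divfK.
set S := \sum_x _; have : S = add_char R p n c * S.
  rewrite {1}/S (reindex_inj (addrI v)) big_distrr /=; apply: eq_bigr => x _.
  by rewrite dotDl (add_charD _ p_pr cardF) vw.
move/eqP; rewrite -subr_eq0 -{1}[S]mul1r -mulrBl mulf_eq0 subr_eq0 eq_sym (negbTE nc).
by move/eqP.
Qed.
End Orthogonality.

(** * The 2d-th moment of the extension *)

Section Moment.
Variables (R : realType) (F : finFieldType) (p n d : nat).
Hypotheses (d_gt0 : (0 < d)%N) (p_pr : prime p) (n_gt0 : (0 < n)%N) (d_lt_p : (d < p)%N).
Hypothesis cardF : #|F| = (p ^ n)%N.

Let param (xi : Gamma F d) : F := val xi ord0 (Ordinal d_gt0).

Let paramE (xi : Gamma F d) : val xi = moment_point d (param xi).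
Proof.
have /imsetP[t _ e] := valP xi.
by rewrite /param e; congr moment_point; rewrite mxE expr1.
Qed.

Let param_inj : injective param.
Proof. by move=> x y e; apply: val_inj; rewrite !paramE e. Qed.

Lemma card_Gamma : #|Gamma F d| = #|F|.
Proof.
rewrite card_sig -[LHS]/#|moment_curve F d| card_imset // => s t /rowP/(_ (Ordinal d_gt0)).
by rewrite !mxE !expr1.
Qed.

(** The coordinates of a sum of [d] points are the power sums of exponents 1 to [d] of the
    parameters; [d < p] makes these exponents invertible in [F], as [power_sums_perm_eq] demands. *)
Lemma sum_Gamma_eq (t u : {ffun 'I_d -> Gamma F d}) :
  (\sum_i val (t i) == \sum_i val (u i)) = perm_eq (codom t) (codom u).
Proof.
apply/eqP/idP => [e|h]; last first.
  have E (v : {ffun 'I_d -> Gamma F d}) : \sum_i val (v i) = \sum_(xi <- codom v) val xi.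
    by rewrite big_map big_enum.
  by rewrite !E (perm_big _ h).
apply: (perm_map_inj param_inj).
suff: perm_eq (codom (param \o t)) (codom (param \o u)) by rewrite /codom /image_mem !map_comp.
apply: power_sums_perm_eq => k /andP[k0 kd].
  rewrite -(dvdn_pcharf (card_finPcharP cardF p_pr)).
  by apply/negP => /(dvdn_leq k0); rewrite leqNgt (leq_ltn_trans kd).
(* Coordinates are numbered from 0, so the [k]-th powers sit at index [k.-1]. *)
have kd' : (k.-1 < d)%N by rewrite prednK.
have E (v : {ffun 'I_d -> Gamma F d}) :
    \sum_i (param \o v) i ^+ k = (\sum_i val (v i)) ord0 (Ordinal kd').
  by rewrite summxE; apply: eq_bigr => i _; rewrite [in RHS]paramE mxE prednK.
by rewrite !E e.
Qed.

Lemma normc_sqr (z : R[i]) : (normc z ^+ 2)%:C = z * conjc z.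
Proof. by rewrite -sqr_normc rmorphXn. Qed.

Lemma normc_exp (z : R[i]) (k : nat) :
  (normc z ^+ (2 * k))%:C = z ^+ k * conjc (z ^+ k).
Proof.
rewrite -normc_sqr; congr (_%:C).
elim: k => [|k IHk]; first by rewrite muln0 !expr0 normc1 expr1n.
by rewrite mulnS exprD IHk [z ^+ k.+1]exprS normcM exprMn.
Qed.

Lemma extension_exp (f : Gamma F d -> R[i]) (x : 'rV[F]_d) :
  extension p n f x ^+ d = (#|F| ^ d)%:R^-1 *
  \sum_(t : {ffun 'I_d -> Gamma F d}) (\prod_i f (t i)) *
     add_char R p n (dot x (\sum_i val (t i))).
Proof.
have add_char_sum (t : 'I_d -> Gamma F d) :
    add_char R p n (dot x (\sum_i val (t i))) = \prod_i add_char R p n (dot x (val (t i))).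
  apply: (big_morph (fun w => add_char R p n (dot x w))) => [w y|].
    by rewrite dotDr (add_charD _ p_pr cardF).
  by rewrite dot0r (add_char0 _ p_pr cardF).
rewrite /extension exprMn natrX exprVn; congr (_ * _).
rewrite -[X in _ ^+ X = _](card_ord d) -prodr_const bigA_distr_bigA /=.
by apply: eq_bigr => t _; rewrite add_char_sum big_split.
Qed.

(** The [d]-th power of the extension times its conjugate is a double sum over tuples; summation
    over [x] leaves the pairs with equal sums of points, which are the rearrangements. *)
Lemma sum_normc_extension (f : Gamma F d -> R[i]) :
  \sum_x normc (extension p n f x) ^+ (2 * d) =
  (#|F| ^ d)%:R^-1 * (d`!%:R ^+ 2 * (\prod_xi bessel_poly d (normc (f xi) ^+ 2))`_d).
Proof.
set Q := (#|F| ^ d)%N.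
have Q0 : Q%:R != 0 :> R[i] by rewrite pnatr_eq0 -lt0n /Q expn_gt0 cardF expn_gt0 prime_gt0.
rewrite -sum_perm_eq_bessel; apply: complexI.
rewrite rmorphM fmorphV rmorph_nat rmorph_sum.
pose Ft (t : {ffun 'I_d -> Gamma F d}) : R[i] := \prod_i f (t i).
pose w (t : {ffun 'I_d -> Gamma F d}) := \sum_i val (t i).
transitivity (\sum_x \sum_t \sum_u Q%:R^-1 ^+ 2 * (Ft t * conjc (Ft u)) *
   add_char R p n (dot x (w t - w u))).
  apply: eq_bigr => x _; rewrite [LHS]normc_exp extension_exp -/Q.
  have -> (a : R[i]) : conjc (Q%:R^-1 * a) = Q%:R^-1 * conjc a.
    by rewrite [LHS]rmorphM fmorphV rmorph_nat.
  rewrite mulrACA -expr2.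
  have -> (I : finType) (E : I -> R[i]) : conjc (\sum_u E u) = \sum_u conjc (E u).
    exact: rmorph_sum.
  rewrite big_distrl big_distrr /=; apply: eq_bigr => t _.
  rewrite !big_distrr /=; apply: eq_bigr => u _.
  have -> (a b : R[i]) : conjc (a * b) = conjc a * conjc b by exact: rmorphM.
  rewrite (conjc_add_char _ p_pr cardF) -dotNr dotDr (add_charD _ p_pr cardF).
  by rewrite -[RHS]mulrA; congr (_ * _); exact: mulrACA.
rewrite exchange_big /= rmorph_sum big_distrr /=; apply: eq_bigr => t _.
rewrite exchange_big /= rmorph_sum big_distrr /= [RHS]big_mkcond /=; apply: eq_bigr => u _.
rewrite -big_distrr /= sum_add_char_dot // subr_eq0 sum_Gamma_eq.
case: ifP => [h|_]; last by rewrite mulr0.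
rewrite -/Q (_ : Ft u = Ft t); last first.
  by rewrite /Ft !prod_codom_count; apply: eq_bigr => v _; rewrite (permP h).
(* Orthogonality contributes [q^d], which cancels one of the two factors [q^-d]. *)
rewrite mulrC expr2 -!mulrA mulVKf //; congr (_ * _).
have -> : conjc (Ft t) = \prod_i conjc (f (t i)) by exact: rmorph_prod.
rewrite -big_split; transitivity (\prod_i (normc (f (t i)) ^+ 2)%:C).
  by apply: eq_bigr => i _; rewrite normc_sqr.
exact/esym/rmorph_prod.
Qed.
End Moment.

(** * Extremizers *)

Lemma powR_invK (R : realType) (x : R) (r : nat) : (0 < r)%N -> 0 <= x ->
  (x `^ r%:R^-1) ^+ r = x.
Proof.
by move=> r0 x0; rewrite -powR_mulrn ?powR_ge0 // -powRrM mulVf ?powRr1 // pnatr_eq0 -lt0n.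
Qed.

(** The coefficient of [X^d] is homogeneous of degree [d] in the parameters. *)
Lemma coef_prod_bessel_const (R : realFieldType) (G : finType) (d : nat) (m : R) :
  (\prod_(x : G) bessel_poly d m)`_d = (\prod_(x : G) bessel_poly d 1)`_d * m ^+ d.
Proof.
rewrite !coef_prod_bessel big_distrl /=; apply: eq_bigr => k /eqP sk.
rewrite -[in m ^+ d]sk expr_sum -big_split; apply: eq_bigr => x _.
by rewrite expr1n mul1r mulrC.
Qed.

Section Extremizers.
Variables (R : realType) (F : finFieldType) (p n d : nat).
Hypotheses (d_gt1 : (1 < d)%N) (p_pr : prime p) (n_gt0 : (0 < n)%N) (d_lt_p : (d < p)%N).
Hypothesis cardF : #|F| = (p ^ n)%N.
Implicit Type f : Gamma F d -> R[i].

Let d_gt0 : (0 < d)%N := ltnW d_gt1.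
Let r_gt0 : (0 < 2 * d)%N.
Proof. by rewrite muln_gt0. Qed.

Let q_gt0 : 0 < #|F|%:R :> R.
Proof. by rewrite ltr0n cardF expn_gt0 prime_gt0. Qed.

Let sum_normc_sqr f :
  \sum_xi normc (f xi) ^+ 2 = #|Gamma F d|%:R * norm_L2_Gamma f ^+ 2.
Proof.
rewrite card_Gamma // sqr_sqrtr ?mulVKf ?gt_eqF //.
by rewrite mulr_ge0 ?invr_ge0 ?ler0n ?sumr_ge0 // => xi _; rewrite sqr_ge0.
Qed.

Let moment_ge0 f : 0 <= \sum_x normc (extension p n f x) ^+ (2 * d).
Proof. by apply: sumr_ge0 => x _; rewrite exprM exprn_ge0 // sqr_ge0. Qed.

Let norm_Lr_exp f : norm_Lr (2 * d) (extension p n f) ^+ (2 * d) =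
  \sum_x normc (extension p n f x) ^+ (2 * d).
Proof. by rewrite powR_invK. Qed.

(** The right-hand side takes the form of the moment formula at the constant function with the same
    mean, so the inequality compares two values of one coefficient. *)
Let sharp_const_exp f : (sharp_const R #|F| d * norm_L2_Gamma f) ^+ (2 * d) =
  (#|F| ^ d)%:R^-1 *
    (d`!%:R ^+ 2 * (\prod_(xi : Gamma F d) bessel_poly d (norm_L2_Gamma f ^+ 2))`_d).
Proof.
have dq : (d <= #|Gamma F d|)%N.
  rewrite card_Gamma // cardF ltnW // (leq_trans d_lt_p) // -[leqLHS]expn1.
  by rewrite leq_exp2l ?prime_gt1.
have A0 : 0 <= sharp_A R #|F| d.
  apply: mulr_ge0; first by rewrite invr_ge0 ler0n.
  apply: sumr_ge0 => l _; apply: mulr_ge0; first exact: sqr_ge0.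
  by apply: divr_ge0; rewrite ?ler0n // prodr_ge0.
rewrite exprMn powR_invK // -(card_Gamma F d_gt0) sharp_A_bessel // (coef_prod_bessel_const _ _ (_ ^+ 2)).
by rewrite card_Gamma // exprM !mulrA.
Qed.

Let norm_ge0 f : 0 <= norm_Lr (2 * d) (extension p n f).
Proof. exact: powR_ge0. Qed.

Let sharp_ge0 f : 0 <= sharp_const R #|F| d * norm_L2_Gamma f.
Proof. by rewrite mulr_ge0 ?powR_ge0 ?sqrtr_ge0. Qed.

Lemma norm_extension_eq f : (forall xi, normc (f xi) ^+ 2 = norm_L2_Gamma f ^+ 2) ->
  norm_Lr (2 * d) (extension p n f) = sharp_const R #|F| d * norm_L2_Gamma f.
Proof.
move=> f_const; apply/eqP; rewrite -(eqrXn2 r_gt0) // norm_Lr_exp sharp_const_exp.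
rewrite sum_normc_extension //.
by under eq_bigr => xi _ do rewrite f_const.
Qed.

(** Both sides are nonnegative, so their [2d]-th powers can be compared; [coef_prod_bessel_max] then
    applies with [|f|^2] for [a]. *)
Lemma norm_extension_lt f : (exists xi, normc (f xi) ^+ 2 != norm_L2_Gamma f ^+ 2) ->
  norm_Lr (2 * d) (extension p n f) < sharp_const R #|F| d * norm_L2_Gamma f.
Proof.
move=> nf; rewrite -(ltr_pXn2r r_gt0) ?nnegrE // norm_Lr_exp sharp_const_exp.
rewrite sum_normc_extension // !ltr_pM2l ?invr_gt0 ?exprn_gt0 ?ltr0n ?fact_gt0 //.
  exact: (coef_prod_bessel_max d_gt1 (fun xi => sqr_ge0 (normc (f xi))) (sum_normc_sqr f) nf).
by rewrite expn_gt0 cardF expn_gt0 prime_gt0.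
Qed.
End Extremizers.

Theorem theorem2 (R : realType) (F : finFieldType) (p n d : nat)
    (hd : (2 <= d)%N) (hp : prime p) (hn : (0 < n)%N) (hpd : (d < p)%N)
    (hF : #|F| = (p ^ n)%N) :
  [/\ (forall f : Gamma F d -> R[i],
         norm_Lr (2 * d) (extension p n f)
         <= sharp_const R #|F| d * norm_L2_Gamma f),
      (forall C : R,
         (forall f : Gamma F d -> R[i],
            norm_Lr (2 * d) (extension p n f) <= C * norm_L2_Gamma f) ->
         sharp_const R #|F| d <= C) &
      (forall f : Gamma F d -> R[i],
         (exists xi, f xi != 0) ->
         (norm_Lr (2 * d) (extension p n f)
            = sharp_const R #|F| d * norm_L2_Gamma f
          <-> exists c : R, forall xi, normc (f xi) = c))].
Proof.
have normc_ge0 (z : R[i]) : 0 <= normc z by case: z => a b; exact: sqrtr_ge0.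
have norm_L2_const (f : Gamma F d -> R[i]) (c : R) :
    (forall xi, normc (f xi) = c) -> norm_L2_Gamma f ^+ 2 = c ^+ 2.
  move=> fc; rewrite /norm_L2_Gamma (eq_bigr (fun=> c ^+ 2)) => [|xi _]; last by rewrite fc.
  rewrite sumr_const card_Gamma ?(ltnW hd) // -[c ^+ 2 *+ _]mulr_natl mulKf ?sqr_sqrtr ?sqr_ge0 //.
  by rewrite pnatr_eq0 -lt0n hF expn_gt0 prime_gt0.
have dichotomy (f : Gamma F d -> R[i]) :
    {forall xi, normc (f xi) ^+ 2 = norm_L2_Gamma f ^+ 2} +
    {exists xi, normc (f xi) ^+ 2 != norm_L2_Gamma f ^+ 2}.
  case: (boolP [forall xi, normc (f xi) ^+ 2 == norm_L2_Gamma f ^+ 2]) => [/forallP h|].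
    by left=> xi; exact/eqP.
  by rewrite negb_forall => /existsP h; right.
split.
- move=> f; have [h|nh] := dichotomy f; last exact/ltW/norm_extension_lt.
  by rewrite norm_extension_eq.
(* The constant function 1 has norm 1 and attains equality, so testing [C] on it gives the lower
   bound. *)
- move=> C /(_ (fun=> 1)) hC; pose one : Gamma F d -> R[i] := fun=> 1.
  have N1 : norm_L2_Gamma one = 1.
    apply/eqP; rewrite -(eqrXn2 (n := 2)) ?ler01 ?sqrtr_ge0 //; apply/eqP.
    by apply: norm_L2_const => xi; exact: normc1.
  move: hC; rewrite -/one norm_extension_eq ?N1 ?mulr1 //.
  by move=> xi; rewrite normc1.
- move=> f _; split=> [e|[c fc]].
    have [h|nh] := dichotomy f; last first.
      by have := norm_extension_lt hd hp hn hpd hF nh; rewrite e ltxx.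
    exists (norm_L2_Gamma f) => xi; apply/eqP.
    by rewrite -(eqrXn2 (n := 2)) ?sqrtr_ge0 // h.
  by apply: norm_extension_eq => // xi; rewrite fc (norm_L2_const _ _ fc).
Qed.
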